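(* Let $d\ge 2$, let $G$ be a finite group, let $\nu_d$ be a $d$-cocycle of $G$, and let $\Lambda$ be a $(d+1)$-colored $d$-dimensional lattice whose boundary $\partial\Lambda$ is $d$-colored, as in the context. Let $|\psi\rangle=|\psi_{trivial}\rangle\otimes|\psi_{SPT}(\nu_d)\rangle\in\mathcal{H}_0^{sym}$, and for a vertex $v\in\partial\Lambda$ let $O_v=\sum_{g\in G}U_{\nu_d}(L_-^g)_vU_{\nu_d}^\dagger$. Then: (i) For a vertex $v\in\partial\Lambda$ of color $a_j$ ($1\le j\le d$), the operator on $\mathcal{H}_1$ $$\hat O_v=\sum_{g\in G}A^g_v\prod_{\Delta\ni v}T_{\Delta,g},$$ where $\Delta$ runs over the $(d-1)$-simplexes of $\partial\Lambda$ containing $v$ and $T_{\Delta,g}$ multiplies each computational basis state by the phase $$\nu_d(\tilde g_1,\tilde g_2,\ldots,\tilde g_j,\tilde g_jg^{-1},\tilde g_{j+1},\ldots,\tilde g_d)^{-(-1)^{j}S(\Delta)}$$ (with $\tilde g_1=1$ and, for $i\geq 2$, $\tilde g_i$ the value on the edge of $\Delta$ from its vertex of color $a_1$ to its vertex of color $a_i$), is a corresponding operator of $O_v$: $\Gamma(O_v|\phi\rangle)=\hat O_v\Gamma(|\phi\rangle)$ for all $|\phi\rangle\in\mathcal{H}_0^{sym}$. (ii) Restricted to the gauge symmetric subspace $\mathcal{H}_1^{sym}$, the Hamiltonian $$\hat H=-\sum_{v\in\Lambda\setminus\partial\Lambda}A_v-\sum_{v\in\partial\Lambda}\hat O_v-\sum_pB_p$$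 is commuting (all its terms preserve $\mathcal{H}_1^{sym}$ and pairwise commute there) and frustration-free (there is a nonzero state in $\mathcal{H}_1^{sym}$ that simultaneously minimizes every term on $\mathcal{H}_1^{sym}$).
   Context: Lattice: $\Lambda$ is a finite connected triangulated $d$-manifold with boundary whose vertices are colored by $a_0,\ldots,a_d$ so that adjacent vertices have different colors; the boundary $\partial\Lambda$ is a closed triangulated $(d-1)$-manifold using only colors $a_1,\ldots,a_d$. Each edge is directed from color $a_i$ to color $a_k$ when $i<k$. Each $d$-simplex has a parity $S=\pm1$, with $d$-simplexes sharing a $(d-1)$-simplex having opposite parities; a $(d-1)$-simplex of $\partial\Lambda$ has the parity of the $d$-simplex containing it, and two $(d-1)$-simplexes of $\partial\Lambda$ sharing a $(d-2)$-simplex have opposite parities (every $(d-2)$-simplex of $\partial\Lambda$ lies in exactly two $(d-1)$-simplexes of $\partial\Lambda$). Cocycles: a $d$-cocycle is a function $\nu_d:G^{d+1}\to U(1)$ with $\nu_d(gg_0,\ldots,gg_d)=\nu_d(g_0,\ldots,g_d)$ for all $g\in G$ and $\prod_{j=0}^{d+1}\nu_d(g_0,\ldots,g_{j-1},g_{j+1},\ldots,g_{d+1})^{(-1)^j}=1$. Hilbert spaces: $\mathcal{H}_0$ (resp. $\mathcal{H}_1$) is the tensor product over vertices (resp. edges) of copies of $\mathbb{C}^{G}$ with basis $\{|g\rangle\}_{g\in G}$. $L_+^g|h\rangle=|gh\rangle$, $L_-^g|h\rangle=|hg^{-1}\rangle$. $S^g=\bigotimes_v(L_+^g)_v$, and $\mathcal{H}_0^{sym}$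 is the subspace of $\mathcal{H}_0$ fixed by all $S^g$. For a closed loop $\gamma$ of edges, $B(\gamma)$ is the projector onto the span of basis states of $\mathcal{H}_1$ with trivial ordered product of edge values along $\gamma$ (inverse value if traversed backwards); $B_p$ is $B(\gamma)$ for $\gamma$ the boundary of the plaquette ($2$-simplex) $p$; $\mathcal{H}_1^{sym}$ is the common $+1$ eigenspace of all $B(\gamma)$, contractible or not. Gauging map: on basis states $\Gamma$ sends vertex values $(v_i)$ to the edge-basis state with value $v_i^{-1}v_k$ on the edge $i\to k$; on $\mathcal{H}_0^{sym}$ it is the linear map $\Gamma(\sum C_{v}|v\rangle)=|G|^{-1/2}\sum C_v\Gamma(|v\rangle)$, with image in $\mathcal{H}_1^{sym}$. Vertex terms: $A_v^g$ applies $L_+^g$ to every edge directed out of $v$ and $L_-^g$ to every edge directed into $v$; $A_v=\frac1{|G|}\sum_gA_v^g$. States: with $|+\rangle=|G|^{-1/2}\sum_g|g\rangle$, $|\psi_{trivial}\rangle$ is the product of $|+\rangle$ over vertices of $\Lambda\setminus\partial\Lambda$, and $|\psi_{SPT}(\nu_d)\rangle=U_{\nu_d}|+\rangle^{\otimes|\partial\Lambda|}$ on the vertices of $\partial\Lambda$, where $U_{\nu_d}$ is the diagonal unitary multiplying each basis state by $\prod_\Delta\nu_d(1,g_1^\Delta,\ldots,g_d^\Delta)^{S(\Delta)}$, the product being over $(d-1)$-simplexes $\Delta$ of $\partial\Lambda$ and $g_i^\Delta$ being the value at the vertex of $\Delta$ of color $a_i$. *)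

(* Defs.v *)
From mathcomp Require Import boolp classical_sets functions reals topology.
From mathcomp Require Import normedtype.
From mathcomp Require Import all_boot all_order all_algebra all_fingroup.
From mathcomp Require Import complex.
Import numFieldNormedType.Exports.
Import Order.TTheory GRing.Theory Num.Theory.

Set Implicit Arguments.
Unset Strict Implicit.
Unset Printing Implicit Defensive.

Local Open Scope ring_scope.

(* ---------------------------------------------------------------------- *)
(* Topological manifolds, as subspaces of some R^N                        *)
(* ---------------------------------------------------------------------- *)
Section Topology.
Local Open Scope classical_set_scope.

Definition homeo (T U : topologicalType) (A : set T) (B : set U)
    (f : T -> U) (g : U -> T) : Prop :=
  [/\ set_fun A B f /\ set_fun B A g,
      {in A, cancel f g}, {in B, cancel g f},
      {within A, continuous f} & {within B, continuous g}].

Variable R : realType.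

Definition half_space (n : nat) : set 'rV[R]_n :=
  [set y | forall i : 'I_n, i = 0%N :> nat -> 0 <= y 0 i].

Definition wall (n : nat) : set 'rV[R]_n :=
  [set y | forall i : 'I_n, i = 0%N :> nat -> y 0 i = 0].

(* X is a topological n-manifold whose boundary is dX: every point has a
   neighbourhood homeomorphic to an open subset of the half space, the points
   of dX being exactly those sent to the wall.  For dX = set0 the charts land
   in the open half space, i.e. X is a manifold without boundary. *)
Definition manifold_with_boundary (n N : nat) (X dX : set 'rV[R]_N) : Prop :=
  dX `<=` X /\
  forall x, X x -> exists (W : set 'rV[R]_N) (O : set 'rV[R]_n) f g,
    [/\ open W, W x, open O,
        homeo (X `&` W) (@half_space n `&` O) f g &
        forall y, (X `&` W) y -> (dX y <-> wall (f y))].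

Definition closed_manifold (n N : nat) (X : set 'rV[R]_N) : Prop :=
  compact X /\ manifold_with_boundary n X classical_sets.set0.

(* Points are given by their barycentric coordinates. *)
Definition realization (V : finType) (K : {set {set V}}) : set 'rV[R]_#|V| :=
  [set x | [/\ forall i, 0 <= x 0 i, \sum_i x 0 i = 1 &
               [set v : V | x 0 (enum_rank v) != 0]%SET \in K]].

End Topology.

(* ---------------------------------------------------------------------- *)
(* The lattice                                                            *)
(* ---------------------------------------------------------------------- *)

(* A simplex is the set of its vertices, so a k-simplex has k.+1 elements.
   Vertex colors a_0, ..., a_d are the elements of 'I_d.+1. The value of
   parity is relevant only on d-simplexes. *)
Record colored_complex (d : nat) := ColoredComplex {
  vertex : finType;
  simplices : {set {set vertex}};
  color : vertex -> 'I_d.+1;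
  parity : {set vertex} -> int
}.

Section Lattice.
Variables (d : nat) (L : colored_complex d).
Notation V := (vertex L).
Notation K := (simplices L).

Definition adj : rel V := [rel u v | (u != v) && ([set u; v] \in K)].

Definition cells : {set {set V}} := [set s in K | #|s| == d.+1].

Definition bd_facets : {set {set V}} :=
  [set D in K | (#|D| == d) && (#|[set s in cells | D \subset s]| == 1%N)].

Definition bd_simplices : {set {set V}} :=
  [set s in K | [exists D in bd_facets, s \subset D]].

Definition bd_vertices : {set V} := [set v | [set v] \in bd_simplices].

(* The parity of the unique d-simplex containing D. *)
Definition bd_parity (D : {set V}) : int :=
  oapp (@parity d L) 1 [pick s in cells | D \subset s].

Record lattice (R : realType) : Prop := IsLattice {
  simplex_neq0 : forall s : {set V}, s \in K -> s != set0;
  simplex_face : forall s t : {set V},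
    s \in K -> t \subset s -> t != set0 -> t \in K;
  simplex_vertex : forall v : V, [set v] \in K;
  lattice_pure : forall s : {set V}, s \in K ->
    exists2 t : {set V}, t \in cells & s \subset t;
  lattice_nonbranching : forall D : {set V}, D \in K -> #|D| = d ->
    (#|[set s in cells | D \subset s]| <= 2)%N;
  lattice_neq0 : (0 < #|V|)%N;
  lattice_connected : forall u v : V, connect adj u v;
  lattice_manifold :
    manifold_with_boundary d (realization (R := R) K)
                             (realization (R := R) bd_simplices);
  boundary_closed_manifold :
    closed_manifold d.-1 (realization (R := R) bd_simplices);
  boundary_nonbranching : forall F : {set V},
    F \in bd_simplices -> #|F| = d.-1 ->
    #|[set D in bd_facets | F \subset D]| = 2%N;
  color_proper : forall u v : V, adj u v -> color u != color v;
  color_boundary : forall v : V, v \in bd_vertices -> color v != ord0;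
  parity_sign : forall s : {set V}, s \in cells ->
    parity s = 1 \/ parity s = -1;
  parity_opposite : forall s t : {set V}, s \in cells -> t \in cells ->
    s != t -> #|s :&: t| = d -> parity s = - parity t;
  bd_parity_opposite : forall D E : {set V}, D \in bd_facets ->
    E \in bd_facets -> D != E -> #|D :&: E| = d.-1 ->
    bd_parity D = - bd_parity E
}.

(* (u, v) stands for the edge directed from u to v. *)
Definition edge : finType :=
  {e : V * V | adj e.1 e.2 && (color e.1 < color e.2)%N}.

Definition plaquette : finType := {p : {set V} | (p \in K) && (#|p| == 3)}.

Definition vertex_of_color (D : {set V}) (i : nat) : option V :=
  [pick v in D | (color v : nat) == i].

End Lattice.

(* ---------------------------------------------------------------------- *)
(* Cocycles                                                               *)
(* ---------------------------------------------------------------------- *)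

Definition cocycle (C : numClosedFieldType) (G : finGroupType) (d : nat)
    (nu : {ffun 'I_d.+1 -> G} -> C) : Prop :=
  [/\ forall t, `|nu t| = 1,
      forall g (t : {ffun 'I_d.+1 -> G}), nu [ffun i => (g * t i)%g] = nu t &
      forall t : {ffun 'I_d.+2 -> G},
        \prod_(j < d.+2) nu [ffun i => t (lift j i)] ^ ((-1) ^+ j : int) = 1].

(* ---------------------------------------------------------------------- *)
(* Hilbert spaces with a finite computational basis                       *)
(* ---------------------------------------------------------------------- *)
Section Hilbert.
Variable C : numClosedFieldType.

(* The space with orthonormal basis X; phi x is the amplitude of |x>. *)
Definition hilb (X : finType) := {ffun X -> C^o}.

Definition inner (X : finType) (phi chi : hilb X) : C :=
  \sum_x (phi x)^* * chi x.

(* The linear map |x> |-> w x |f x>. *)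
Definition basis_map (X Y : finType) (f : X -> Y) (w : X -> C)
    (phi : hilb X) : hilb Y :=
  [ffun y => \sum_(x | f x == y) w x * phi x].

Definition diag (X : finType) (w : X -> C) : hilb X -> hilb X :=
  basis_map id w.

Definition energy (X : finType) (h : hilb X -> hilb X) (phi : hilb X) : C :=
  inner phi (h phi) / inner phi phi.

(* On a numClosedFieldType, a <= b means that b - a is real and nonnegative;
   hence all energies on W are required to be real. *)
Definition minimizes (X : finType) (W : hilb X -> Prop)
    (h : hilb X -> hilb X) (phi : hilb X) : Prop :=
  energy h phi \is Num.real /\
  forall chi, W chi -> chi != 0 -> energy h phi <= energy h chi.

Definition commuting (X T : finType) (W : hilb X -> Prop)
    (h : T -> hilb X -> hilb X) : Prop :=
  (forall t phi, W phi -> W (h t phi)) /\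
  (forall t s phi, W phi -> h t (h s phi) = h s (h t phi)).

Definition frustration_free (X T : finType) (W : hilb X -> Prop)
    (h : T -> hilb X -> hilb X) : Prop :=
  exists phi, [/\ W phi, phi != 0 & forall t, minimizes W (h t) phi].

End Hilbert.

(* ---------------------------------------------------------------------- *)
(* The models on vertices and on edges                                    *)
(* ---------------------------------------------------------------------- *)
Section Model.
Variables (C : numClosedFieldType) (G : finGroupType).
Variables (d : nat) (L : colored_complex d).
Variable nu : {ffun 'I_d.+1 -> G} -> C.
Notation V := (vertex L).

Definition vconf : finType := {ffun V -> G}.
Definition econf : finType := {ffun edge L -> G}.
Definition H0 := hilb C vconf.
Definition H1 := hilb C econf.

Definition Lplus (g h : G) : G := (g * h)%g.
Definition Lminus (g h : G) : G := (h * g^-1)%g.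

Definition sym_op (g : G) : H0 -> H0 :=
  basis_map (fun x : vconf => [ffun v => Lplus g (x v)]) (fun=> 1).

Definition H0sym (phi : H0) : Prop := forall g, sym_op g phi = phi.

(* The value read when stepping from u to the adjacent vertex w. *)
Definition edge_step (e : econf) (u w : V) : G :=
  if insub (u, w) is Some k then e k
  else if insub (w, u) is Some k then (e k)^-1%g
  else 1%g.

(* The cyclic sequence c = [:: v_0; ...; v_n] stands for the closed loop
   v_0, ..., v_n, v_0. *)
Definition holonomy (c : seq V) (e : econf) : G :=
  (\prod_(uw <- zip c (rot 1 c)) edge_step e uw.1 uw.2)%g.

Definition Bloop (c : seq V) : H1 -> H1 :=
  diag (fun e => (holonomy c e == 1%g)%:R).

(* Any enumeration of the three vertices is a loop around the plaquette; the
   projector depends neither on its base point nor on its orientation. *)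
Definition Bplaq (p : {set V}) : H1 -> H1 := Bloop (enum p).

Definition H1sym (phi : H1) : Prop :=
  forall c, path.cycle (adj (L := L)) c -> Bloop c phi = phi.

Definition gauge_conf (x : vconf) : econf :=
  [ffun k : edge L => ((x (val k).1)^-1 * x (val k).2)%g].

(* Only its values on H0sym matter. *)
Definition Gamma : H0 -> H1 :=
  basis_map gauge_conf (fun=> (sqrtC #|G|%:R)^-1).

Definition Avg (v : V) (g : G) : H1 -> H1 :=
  basis_map (fun e : econf => [ffun k : edge L =>
    if (val k).1 == v then Lplus g (e k)
    else if (val k).2 == v then Lminus g (e k)
    else e k]) (fun=> 1).

Definition Av (v : V) (phi : H1) : H1 :=
  (#|G|%:R)^-1 *: \sum_(g : G) Avg v g phi.

Definition plus : G -> C := fun=> (sqrtC #|G|%:R)^-1.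

(* (1, g_1, ..., g_d): position i >= 1 holds the value at the vertex of D of
   color a_i. *)
Definition facet_tuple (x : vconf) (D : {set V}) : {ffun 'I_d.+1 -> G} :=
  [ffun i : 'I_d.+1 =>
     if i == ord0 then 1%g else oapp x 1%g (vertex_of_color D i)].

Definition spt_phase (x : vconf) : C :=
  \prod_(D in bd_facets L) nu (facet_tuple x D) ^ bd_parity D.

Definition Unu : H0 -> H0 := diag spt_phase.
Definition Unu_dag : H0 -> H0 := diag (fun x => (spt_phase x)^*).

Definition psi_trivial (x : vconf) : C :=
  \prod_(v | v \notin bd_vertices L) plus (x v).

Definition psi_spt (x : vconf) : C :=
  spt_phase x * \prod_(v in bd_vertices L) plus (x v).

(* psi_trivial x and psi_spt x only depend on the values of x at the interior,
   resp. boundary, vertices, so that the product is the tensor product. *)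
Definition psi : H0 := [ffun x => psi_trivial x * psi_spt x].

Definition Lminus_at (v : V) (g : G) : H0 -> H0 :=
  basis_map (fun x : vconf =>
    [ffun w => if w == v then Lminus g (x w) else x w]) (fun=> 1).

Definition Ov (v : V) (phi : H0) : H0 :=
  \sum_(g : G) Unu (Lminus_at v g (Unu_dag phi)).

Definition gtilde (e : econf) (D : {set V}) (i : nat) : G :=
  if i == 1%N then 1%g else
  if (vertex_of_color D 1%N, vertex_of_color D i) is (Some u, Some w)
  then edge_step e u w else 1%g.

(* (g~_1, ..., g~_j, g~_j g^-1, g~_(j+1), ..., g~_d), positions starting
   from 0. *)
Definition That_tuple (e : econf) (D : {set V}) (j : nat) (g : G) :
    {ffun 'I_d.+1 -> G} :=
  [ffun i : 'I_d.+1 =>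
     if (i < j)%N then gtilde e D i.+1
     else if i == j :> nat then (gtilde e D j * g^-1)%g
     else gtilde e D i].

Definition That_phase (v : V) (g : G) (e : econf) : C :=
  \prod_(D in bd_facets L | v \in D)
    nu (That_tuple e D (color v) g) ^
      (- ((-1) ^+ (color v : nat) * bd_parity D) : int).

Definition Ohat (v : V) (phi : H1) : H1 :=
  \sum_(g : G) Avg v g (diag (That_phase v g) phi).

Definition Hhat (phi : H1) : H1 :=
  - (\sum_(v | v \notin bd_vertices L) Av v phi)
  - (\sum_(v in bd_vertices L) Ohat v phi)
  - (\sum_(p : plaquette L) Bplaq (val p) phi).

Definition Hterm (t : V + plaquette L) (phi : H1) : H1 :=
  match t with
  | inl v => if v \in bd_vertices L then - Ohat v phi else - Av v phi
  | inr p => - Bplaq (val p) phi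
  end.

End Model.

(* Main.v *)
Require Import Defs.
From mathcomp Require Import all_boot all_order all_algebra all_fingroup.
From mathcomp Require Import reals complex.
From mathcomp Require Import zify ring.
Import Order.TTheory GRing.Theory Num.Theory.

Set Implicit Arguments.
Unset Strict Implicit.
Unset Printing Implicit Defensive.

Local Open Scope ring_scope.

(* Every flat edge configuration is the gauge image of a vertex configuration,
   unique up to a global left translation, so Gamma is an isometry from the
   symmetric vertex states onto the flat edge states.  Through it the vertex
   terms become scalar multiples of the operators O_v, also for v in the
   interior, where U_nu does not see v.  Each O_v is |G| times an orthogonal
   projector, and O_v = U P_v U^* where P_v sums over the value at v, so the O_v
   commute and psi is in the top eigenspace of all of them.  The formula for
   the phases of the edge operators, and the invariance of U_nu under global
   translations, follow from one cocycle relation per boundary facet: in the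
   product over all facets, the terms omitting a vertex that is not involved
   cancel in pairs of adjacent facets, which have opposite parities. *)

(** * Colored faces of the boundary and cancellation between adjacent facets *)

Section Combinatorics.
Variables (R : realType) (d : nat) (L : colored_complex d).
Hypotheses (hd : (2 <= d)%N) (hL : lattice L R).
Notation V := (vertex L).

(** The face opposite to the vertex of color [i]; selecting by color rather than by vertex makes
    faces of adjacent facets comparable. *)
Definition drop_color (i : nat) (D : {set V}) : {set V} :=
  [set w in D | (color w : nat) != i].

Lemma adj_sym : symmetric (adj (L := L)).
Proof. by move=> u v; rewrite /adj /= eq_sym setUC. Qed.

Lemma facet_simplex (D : {set V}) : D \in bd_facets L -> D \in simplices L.
Proof. by rewrite inE => /andP[]. Qed.

Lemma facet_card (D : {set V}) : D \in bd_facets L -> #|D| = d.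
Proof. by rewrite inE => /and3P[_ /eqP]. Qed.

Lemma facet_bd_simplex (D F : {set V}) : D \in bd_facets L ->
  F \subset D -> F != set0 -> F \in bd_simplices L.
Proof.
move=> DF FD F0; rewrite inE; apply/andP; split.
  exact: (simplex_face hL (facet_simplex DF)).
by apply/existsP; exists D; rewrite DF.
Qed.

Lemma facet_bd_vertex (D : {set V}) w : D \in bd_facets L ->
  w \in D -> w \in bd_vertices L.
Proof.
move=> DF wD; rewrite inE; apply: (facet_bd_simplex DF); first by rewrite sub1set.
by apply/set0Pn; exists w; rewrite inE.
Qed.

Lemma simplex_adj (s : {set V}) u w : s \in simplices L ->
  u \in s -> w \in s -> u != w -> adj u w.
Proof.
move=> sK us ws uw; rewrite /adj /= uw /=; apply: (simplex_face hL sK).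
  by apply/subsetP => z; rewrite !inE => /orP[]/eqP->.
by apply/set0Pn; exists u; rewrite !inE eqxx.
Qed.

Lemma facet_color_inj (D : {set V}) : D \in bd_facets L ->
  {in D &, injective (@color d L)}.
Proof.
move=> DF u w uD wD cuw; apply/eqP/contraT => uw.
have := color_proper hL (simplex_adj (facet_simplex DF) uD wD uw).
by rewrite cuw eqxx.
Qed.

Lemma vertex_of_color_eq (D : {set V}) v : D \in bd_facets L -> v \in D ->
  vertex_of_color D (color v) = Some v.
Proof.
move=> DF vD; rewrite /vertex_of_color; case: pickP => [w|/(_ v)].
  case/andP=> wD /eqP/val_inj cwv.
  by congr Some; apply: (facet_color_inj DF).
by rewrite vD eqxx.
Qed.

(** The [d] vertices of a facet have distinct colors, none of them a_0, so by counting all [d] other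
    colors occur. *)
Lemma facet_has_color (D : {set V}) (i : nat) :
  D \in bd_facets L -> (0 < i <= d)%N ->
  exists w, [/\ w \in D, color w = i :> nat & vertex_of_color D i = Some w].
Proof.
move=> DF /andP[i0 id].
have sub : @color d L @: D \subset [set~ ord0].
  apply/subsetP => _ /imsetP[w wD ->]; rewrite !inE.
  exact: (color_boundary hL (facet_bd_vertex DF wD)).
have eq : @color d L @: D = [set~ ord0].
  apply/eqP; rewrite eqEcard sub /= cardsC1 card_ord.
  by rewrite (card_in_imset (facet_color_inj DF)) (facet_card DF).
have id1 : (i < d.+1)%N by [].
have : Ordinal id1 \in @color d L @: D.
  by rewrite eq !inE -val_eqE /= -lt0n.
case/imsetP=> w wD /(congr1 val) /= ->.
by exists w; split => //; apply: vertex_of_color_eq.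
Qed.

Lemma vertex_of_color_drop (D : {set V}) (i m : nat) : m != i ->
  vertex_of_color (drop_color i D) m = vertex_of_color D m.
Proof.
move=> mi; apply: eq_pick => w; rewrite !inE /=.
by have [->|_] := eqVneq (color w : nat) m; rewrite ?andbF // mi !andbT.
Qed.

Lemma drop_color_mem (D : {set V}) (i : nat) (v : V) : color v != i :> nat ->
  (v \in drop_color i D) = (v \in D).
Proof. by move=> cv; rewrite inE cv andbT. Qed.

Lemma drop_color_card (D : {set V}) (i : nat) :
  D \in bd_facets L -> (0 < i <= d)%N ->
  #|drop_color i D| = d.-1.
Proof.
move=> DF id; have [w [wD cw _]] := facet_has_color DF id.
have -> : drop_color i D = D :\ w.
  apply/setP => z; rewrite !inE; have [zD|_] := boolP (z \in D);
    last by rewrite andbF.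
  rewrite andbT -cw; congr (~~ _); apply/eqP/eqP => [|->//].
  by move/val_inj; apply: (facet_color_inj DF).
by have := cardsD1 w D; rewrite wD (facet_card DF) /=; lia.
Qed.

(* Facets come in pairs of opposite parity sharing all vertices but the one of
   color a_i. *)
Lemma facet_cancel (C : fieldType) (i : nat) (P : pred {set V})
    (f : {set V} -> C) : (0 < i <= d)%N -> (forall F, f F != 0) ->
  \prod_(D in bd_facets L | P (drop_color i D))
     f (drop_color i D) ^ bd_parity D = 1.
Proof.
move=> id f0.
rewrite (partition_big (drop_color i) xpredT) //=; apply: big1 => F _.
have [/existsP[D0 /andP[D0F /eqP eF]]|/existsPn noD] :=
    boolP [exists D0, (D0 \in bd_facets L) && (drop_color i D0 == F)]; last first.
  apply: big_pred0 => D; move: (noD D).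
  by case: (D \in _) => //= /negPf->; rewrite andbF.
have cF : #|F| = d.-1 by rewrite -eF drop_color_card.
have FD0 : F \subset D0.
  by rewrite -eF; apply/subsetP => w; rewrite inE => /andP[].
have F0 : F != set0 by rewrite -card_gt0 cF; lia.
have /eqP := boundary_nonbranching hL (facet_bd_simplex D0F FD0 F0) cF.
case/cards2P => D1 [D2 [D12 eD]].
(* [F] has no vertex of color [i], so it lies in what a facet [E] containing it keeps after dropping
   that color; equal cardinality makes them equal. *)
have h E : (E \in bd_facets L) && (drop_color i E == F) = (E \in [set D1; D2]).
  rewrite -eD inE; have [EF|]//= := boolP (E \in bd_facets L).
  apply/eqP/idP => [<-|FE]; first by apply/subsetP => w; rewrite inE => /andP[].
  apply/esym/eqP; rewrite eqEcard drop_color_card // cF leqnn andbT.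
  apply/subsetP => w wF; rewrite inE (subsetP FE) //=.
  by move: wF; rewrite -eF inE => /andP[].
have [PF|nPF] := boolP (P F); last first.
  apply: big_pred0 => D; apply/negP => /andP[/andP[_ PD] /eqP DF].
  by move: nPF; rewrite -DF PD.
rewrite (eq_bigl (fun D => D \in [set D1; D2])); last first.
  move=> D; rewrite -h; have [->|] := eqVneq (drop_color i D) F.
    by rewrite PF !andbT.
  by rewrite !andbF.
have := h D1; rewrite in_set2 eqxx /= => /andP[D1F /eqP e1].
have := h D2; rewrite in_set2 eqxx orbT /= => /andP[D2F /eqP e2].
(* Opposite parity requires exactly [d.-1] common vertices: at least those of [F], and not all [d],
   as the facets differ. *)
have D12c : #|D1 :&: D2| = d.-1.
  have l1 : (d.-1 <= #|D1 :&: D2|)%N.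
    rewrite -cF subset_leq_card // subsetI -{1}e1 -e2.
    by apply/andP; split; apply/subsetP => w; rewrite inE => /andP[].
  have l2 : (#|D1 :&: D2| <= d)%N.
    by rewrite -[X in (_ <= X)%N](facet_card D1F) subset_leq_card // subsetIl.
  have l3 : #|D1 :&: D2| != d.
    apply: contra D12 => /eqP e.
    have a1 : D1 :&: D2 = D1.
      by apply/eqP; rewrite eqEcard subsetIl e (facet_card D1F) leqnn.
    have a2 : D1 :&: D2 = D2.
      by apply/eqP; rewrite eqEcard subsetIr e (facet_card D2F) leqnn.
    by rewrite -{1}a1 a2.
  lia.
rewrite big_setU1 ?inE //= big_set1 e1 e2.
rewrite (bd_parity_opposite hL D1F D2F D12 D12c) -invr_expz mulVf // expfz_neq0 //.
Qed.

End Combinatorics.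

(** * Cocycle relations multiplied over the boundary facets *)

Section Phases.
Variables (R : realType) (d : nat) (L : colored_complex d).
Hypotheses (hd : (2 <= d)%N) (hL : lattice L R).
Variables (C : numClosedFieldType) (G : finGroupType).
Variable nu : {ffun 'I_d.+1 -> G} -> C.
Hypothesis hnu : cocycle nu.
Notation V := (vertex L).
Notation vconf := (vconf G L).
Notation facets := (bd_facets L).
Notation upd x v g := [ffun w => if w == v then g else x w].

(** Defined for any vertex set, so that it can also be read off a face with one color dropped; on a
    facet the default 1 is not reached for colors 1 to [d]. *)
Definition color_val (x : vconf) (D : {set V}) (i : nat) : G :=
  oapp x 1%g (vertex_of_color D i).

Lemma color_val_drop x D i m : m != i ->
  color_val x (drop_color i D) m = color_val x D m.
Proof. by move=> mi; rewrite /color_val vertex_of_color_drop. Qed.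

Lemma nu_neq0 t : nu t != 0.
Proof. by rewrite -normr_eq0; case: hnu => -> _ _; rewrite oner_neq0. Qed.

Lemma spt_phase_norm (x : vconf) : spt_phase nu x * (spt_phase nu x)^* = 1.
Proof.
rewrite -normCK /spt_phase normr_prod big1 ?expr1n // => D _.
by case: (bd_parity D) => n /=; rewrite ?normfV normrX; case: hnu => -> _ _;
  rewrite expr1n ?invr1.
Qed.

Lemma spt_phase_neq0 (x : vconf) : spt_phase nu x != 0.
Proof. by apply/prodf_neq0 => D _; rewrite expfz_neq0 // nu_neq0. Qed.

(** The cocycle relation at [t D], raised to the parity of [D], is multiplied over the facets;
    exchanging the products groups the factors by the omitted position [k]. *)
Lemma nu_cocycle_prod (P : pred {set V}) (t : {set V} -> nat -> G) :
  \prod_(k < d.+2) \prod_(D in facets | P D)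
    nu [ffun m : 'I_d.+1 => t D (lift k m)]
      ^ ((-1) ^+ k * bd_parity D : int) = 1.
Proof.
rewrite exchange_big /=; apply: big1 => D _.
case: hnu => _ _ /(_ [ffun i : 'I_d.+2 => t D i])
  /(congr1 (fun z => z ^ bd_parity D)).
rewrite exp1rz (big_morph (fun z : C => z ^ bd_parity D)
  (fun a b => expfzMl a b _) (exp1rz _ _)) /= => e.
rewrite -[RHS]e; apply: eq_bigr => k _; rewrite -exprz_exp.
congr ((nu _ ^ _) ^ _).
by apply/ffunP => m; rewrite !ffunE.
Qed.

(** Only position [k] may depend on the vertex of color [i], so the tuple omitting it is a function
    of the face without that vertex, and [facet_cancel] applies. *)
Lemma nu_cocycle_cancel (P : pred {set V}) (t : {set V} -> nat -> G)
    (k : 'I_d.+2) (i : nat) : (0 < i <= d)%N ->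
  (forall D, P (drop_color i D) = P D) ->
  (forall D (m : nat), m != k -> t (drop_color i D) m = t D m) ->
  \prod_(D in facets | P D)
    nu [ffun m : 'I_d.+1 => t D (lift k m)]
      ^ ((-1) ^+ k * bd_parity D : int) = 1.
Proof.
move=> id hP ht.
rewrite -[RHS](facet_cancel hd hL (i := i) P
  (f := fun D => nu [ffun m : 'I_d.+1 => t D (lift k m)]
                  ^ ((-1) ^+ k : int))) //.
  apply: eq_big => [D|D _]; first by rewrite hP.
  rewrite -exprz_exp; congr ((nu _ ^ _) ^ _).
  apply/ffunP => m; rewrite !ffunE ht //.
  by rewrite eq_sym; apply: neq_bump.
by move=> F; rewrite expfz_neq0 // nu_neq0.
Qed.

(* The cocycle relation at (1, g^-1, x_1, ..., x_d): the terms omitting some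
   x_i cancel between neighbouring facets. *)
Lemma spt_phase_sym g (x : vconf) :
  spt_phase nu [ffun v => (g * x v)%g] = spt_phase nu x.
Proof.
pose t (D : {set V}) (m : nat) :=
  if m == 0%N then 1%g else if m == 1%N then g^-1%g else color_val x D m.-1.
have := nu_cocycle_prod xpredT t.
rewrite !big_ord_recl /= [X in _ * (_ * X)]big1 => [|k _]; last first.
  (* The extra entry g^-1 shifts the colors by one: position k+2 holds color k+1. *)
  apply: (@nu_cocycle_cancel xpredT _ (lift ord0 (lift ord0 k)) k.+1) => //.
    by have := ltn_ord k; lia.
  move=> D m; rewrite /t => mk; do 2 case: eqP => //= _.
  apply: color_val_drop; apply: contra mk => /eqP; rewrite /= /bump /=.
  by case: m => //= m; lia.
rewrite mulr1 /spt_phase => /(canRL (mulfK _)); rewrite mul1r => eq.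
have -> : \prod_(D in facets)
      nu (facet_tuple [ffun v => (g * x v)%g] D) ^ bd_parity D =
    \prod_(D in facets | true) nu [ffun m : 'I_d.+1 => t D (lift ord0 m)]
      ^ ((-1) ^+ 0 * bd_parity D : int).
  apply: eq_big => [D|D DF]; first by rewrite andbT.
  rewrite expr0 mul1r; congr (_ ^ _).
  (* Left translation by g^-1 turns (1, g x_1, ..., g x_d) into (g^-1, x_1, ..., x_d), the tuple
     omitting position 0. *)
  case: hnu => _ /(_ g^-1%g) <- _; congr nu.
  apply/ffunP => m; rewrite !ffunE /t /= /bump /=.
  have [->|m0] := eqVneq m ord0; first by rewrite /= mulg1.
  have m0' : (0 < m <= d)%N by rewrite lt0n m0 -ltnS ltn_ord.
  have [w [_ _ e]] := facet_has_color hL DF m0'.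
  rewrite /color_val e /= ffunE mulKg.
  by case: eqP => // e1; move: m0'; lia.
rewrite eq ?invrK.
- rewrite -prodfV; apply: eq_big => [D|D DF]; first by rewrite andbT.
  rewrite expr1 mulN1r -invr_expz invrK; congr (nu _ ^ _).
  apply/ffunP => m; rewrite !ffunE /t /= /bump /=.
  by case: m => [[|m] hm].
- by apply/prodf_neq0 => D _; rewrite expfz_neq0 // nu_neq0.
Qed.


(** The edge leaves color a_1, so it is read forwards. Edge values are thus vertex values translated
    by x_1^-1, a translation that [nu] ignores. *)
Lemma gtilde_gauge (x : vconf) D i : D \in facets -> (0 < i <= d)%N ->
  gtilde (gauge_conf x) D i = ((color_val x D 1)^-1 * color_val x D i)%g.
Proof.
move=> DF id; rewrite /gtilde /color_val.
have [->|i1] := eqVneq i 1%N; first by rewrite mulVg.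
have [u [uD cu ->]] : exists u, [/\ u \in D, color u = 1%N :> nat &
    vertex_of_color D 1 = Some u].
  by apply: (facet_has_color hL DF); lia.
have [w [wD cw ->]] := facet_has_color hL DF id.
have uw : u != w by apply: contra i1 => /eqP e; rewrite -cw -cu e.
have auw := simplex_adj hL (facet_simplex DF) uD wD uw.
rewrite /edge_step; case: insubP => [k _ e|]; first by rewrite ffunE e.
by rewrite /= auw cu cw; lia.
Qed.

(* The cocycle relation at (1, x_1, ..., x_j, x_j g^-1, x_(j+1), ..., x_d):
   omitting position 0, j and j+1 gives the phase of the edge operator, the new
   and the old phase of U_nu; the other terms cancel between facets. *)
Lemma spt_phase_upd (v : V) g (x : vconf) :
  spt_phase nu (upd x v (x v * g^-1)%g) =
  That_phase nu v g (gauge_conf x) * spt_phase nu x.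
Proof.
(* No facet contains an interior vertex: the phase of [U_nu] does not change and the edge phase is
   an empty product. *)
have [vb|vb] := boolP (v \in bd_vertices L); last first.
  have vD D : D \in facets -> v \notin D.
    by move=> DF; apply: contra vb; apply: (facet_bd_vertex hL DF).
  rewrite /That_phase big_pred0 ?mul1r => [|D]; last first.
    by have [/vD/negPf|] := boolP (D \in facets).
  apply: eq_bigr => D DF; congr (nu _ ^ _).
  apply/ffunP => i; rewrite !ffunE.
  have [//|i0] := eqVneq i ord0.
  have id : (0 < i <= d)%N by rewrite lt0n i0 -ltnS ltn_ord.
  have [w [wD _ ->]] := facet_has_color hL DF id; rewrite /= ffunE.
  by case: eqP => // e; have := vD _ DF; rewrite -e wD.
have := color_boundary hL vb; rewrite -val_eqE /= -lt0n.
move: (ltn_ord (color v)); rewrite ltnS; move ej : (color v : nat) => j jd j0.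
pose t (D : {set V}) (m : nat) :=
    if m == 0%N then 1%g else if (m <= j)%N then color_val x D m
    else if m == j.+1 then (color_val x D j * g^-1)%g else color_val x D m.-1.
pose s (D : {set V}) : int := (-1) ^+ j * bd_parity D.
pose N (k : 'I_d.+2) (D : {set V}) := nu [ffun m : 'I_d.+1 => t D (lift k m)].
pose kj : 'I_d.+2 := inord j.
pose kj1 : 'I_d.+2 := inord j.+1.
have ekj : kj = j :> nat by rewrite inordK //; lia.
have ekj1 : kj1 = j.+1 :> nat by rewrite inordK //; lia.
have prodk (k : 'I_d.+2) : k != ord0 -> k != kj -> k != kj1 ->
    \prod_(D in facets | v \in D) N k D ^ ((-1) ^+ k * bd_parity D : int) = 1.
  rewrite -!val_eqE /= ekj ekj1 => k0 k1 k2.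
  (* The color held at position [k], shifted behind the inserted entry. It differs from [j], so
     dropping it does not affect whether [v] belongs to the facet. *)
  pose i : nat := if (k < j)%N then (k : nat) else k.-1.
  have ij : j != i by rewrite /i; case: ifP; lia.
  apply: (@nu_cocycle_cancel (fun D => v \in D) _ k i).
  - by rewrite /i; have := ltn_ord k; case: ifP; lia.
  - by move=> D; rewrite drop_color_mem // ej.
  - move=> D m mk; rewrite /t; case: ifP => // m0.
    by case: leqP => mj; last case: eqP => mj1;
      rewrite ?color_val_drop // /i; case: ifP; lia.
have := nu_cocycle_prod (fun D => v \in D) t.
rewrite (bigD1 ord0) //= (bigD1 kj) /=; last by rewrite -val_eqE /= ekj -lt0n.
rewrite (bigD1 kj1) /=; last by rewrite -!val_eqE /= ekj ekj1; lia.
rewrite [X in _ * (_ * (_ * X))]big1 => [|k /andP[/andP[k0 k1] k2]]; last exact: prodk.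
rewrite mulr1 -!big_split /= => eq1.
rewrite /spt_phase (bigID (fun D : {set V} => v \in D)) /=
  [X in _ = _ * X](bigID (fun D : {set V} => v \in D)) /=.
rewrite mulrA; congr (_ * _); last first.
  apply: eq_bigr => D /andP[DF vD]; congr (nu _ ^ _).
  apply/ffunP => i; rewrite !ffunE.
  have [//|i0] := eqVneq i ord0.
  have id : (0 < i <= d)%N by rewrite lt0n i0 -ltnS ltn_ord.
  have [w [wD _ ->]] := facet_has_color hL DF id; rewrite /= ffunE.
  by case: eqP => // e; move: vD; rewrite -e wD.
rewrite /That_phase -big_split /=.
(* Raising the relation to the power (-1)^j leaves the parity and its negative as exponents at
   positions j and j+1. *)
have {}eq1 : \prod_(D in facets | v \in D)
    (N ord0 D ^ bd_parity D * (N kj D ^ s D * N kj1 D ^ (- s D)))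
      ^ ((-1) ^+ j : int) = 1.
  rewrite -(big_morph (fun z : C => z ^ ((-1) ^+ j : int))
    (fun a b => expfzMl a b _) (exp1rz _ _)) -[RHS](exp1rz _ ((-1) ^+ j)).
  congr (_ ^ _); rewrite -[RHS]eq1; apply: eq_bigr => D _.
  by congr (_ ^ _ * (_ ^ _ * _ ^ _));
    rewrite ?expr0 ?mul1r // /s ?ekj // ekj1 exprS mulN1r mulNr.
(* The relation is known only for the whole product; once it is multiplied in as a factor 1, the two
   sides agree facet by facet. *)
apply/eqP; rewrite -[X in _ == X]mulr1 -[X in _ == _ * X]eq1 -big_split /=.
apply/eqP; apply: eq_bigr => D /andP[DF vD].
have vj : vertex_of_color D j = Some v.
  by rewrite -ej; apply: (vertex_of_color_eq hL).
have -> : nu (That_tuple (gauge_conf x) D (color v) g) = N ord0 D.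
  case: hnu => _ /(_ (color_val x D 1)) <- _; congr nu; apply/ffunP => m.
  rewrite !ffunE ej /t /= /bump /= add1n; have md := ltn_ord m.
  case: ltngtP => mj.
  - by rewrite gtilde_gauge ?mulKVg //; lia.
  - rewrite gtilde_gauge ?mulKVg //; last lia.
    by case: eqP => // ?; lia.
  - by rewrite gtilde_gauge ?mulgA ?mulKVg ?mulgV ?mul1g //; [rewrite mj eqxx | lia].
have -> : nu (facet_tuple (upd x v (x v * g^-1)%g) D) = N kj D.
  congr nu; apply/ffunP => m; rewrite !ffunE /t /= /bump ekj.
  have [->|m0] := eqVneq m ord0; first by rewrite leqNgt j0.
  have m0' : (0 < m <= d)%N by rewrite lt0n -ltnS ltn_ord andbT.
  have [w [wD cw ew]] := facet_has_color hL DF m0'.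
  have wv : (w == v) = (m == j :> nat).
    apply/eqP/eqP => [e|mj]; first by rewrite -cw e.
    by move: ew; rewrite mj vj => -[].
  rewrite ew /= ffunE wv; case: (ltngtP j m) => mj /=; rewrite ?add1n ?add0n.
  - by rewrite ltnNge (ltnW mj) /= eqSS gtn_eqF // /color_val ew.
  - by rewrite (negPf (m0 : m != 0%N :> nat)) (ltnW mj) /color_val ew.
  - by rewrite -mj ltnn eqxx /color_val vj.
have -> : nu (facet_tuple x D) = N kj1 D.
  congr nu; apply/ffunP => m; rewrite !ffunE /t /= /bump ekj1.
  have [->|m0] := eqVneq m ord0; first by [].
  have [mj|mj] := leqP m j.
    by rewrite add0n /= mj (negPf (_ : m != 0%N :> nat)).
  by rewrite add1n /= ltnNge ltnW //= eqSS gtn_eqF.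
have n0 k : N k D ^ bd_parity D != 0 by rewrite expfz_neq0 // nu_neq0.
rewrite ej /s -signr_odd; case: (odd j);
  rewrite /= ?expr1 ?expr0 ?mul1r ?mulN1r ?opprK;
  rewrite ?exprN1 ?expr1z -!invr_expz;
  move: (n0 ord0) (n0 kj) (n0 kj1);
  move: (N ord0 D ^ _) (N kj D ^ _) (N kj1 D ^ _) => a b c a0 b0 c0.
  by field; rewrite a0 b0 c0.
by field; rewrite a0 c0.
Qed.

End Phases.

(** * Basis maps, inner products and scaled projectors *)

Section HilbertFacts.
Variable C : numClosedFieldType.

Lemma basis_mapE (X Y : finType) (f : X -> Y) (f' : Y -> X) (w : X -> C) phi y :
  cancel f f' -> cancel f' f -> basis_map f w phi y = w (f' y) * phi (f' y).
Proof.
move=> fK f'K; rewrite ffunE (big_pred1 (f' y)) // => x.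
by apply/eqP/eqP => [<-|->]; rewrite ?fK ?f'K.
Qed.

Lemma diagE (X : finType) (w : X -> C) phi x : diag w phi x = w x * phi x.
Proof. exact: basis_mapE. Qed.

Lemma basis_mapZ (X Y : finType) (f : X -> Y) (w : X -> C) (c : C) phi :
  basis_map f w (c *: phi) = c *: basis_map f w phi.
Proof.
apply/ffunP => y; rewrite !ffunE scaler_sumr; apply: eq_bigr => x _.
by rewrite ffunE /GRing.scale /= mulrCA.
Qed.

Lemma innerZr (X : finType) (phi chi : hilb C X) c :
  inner phi (c *: chi) = c * inner phi chi.
Proof.
rewrite /inner mulr_sumr; apply: eq_bigr => x _.
by rewrite ffunE /GRing.scale /= mulrCA.
Qed.

Lemma inner_ge0 (X : finType) (phi : hilb C X) : 0 <= inner phi phi.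
Proof. by apply: sumr_ge0 => x _; rewrite mulrC mul_conjC_ge0. Qed.

Lemma inner_gt0 (X : finType) (phi : hilb C X) : phi != 0 -> 0 < inner phi phi.
Proof.
move=> phi0; rewrite lt0r inner_ge0 andbT; apply: contra phi0.
rewrite psumr_eq0 => [/allP h|x _]; last by rewrite mulrC mul_conjC_ge0.
apply/eqP/ffunP => x; rewrite ffunE; apply/eqP.
by have /implyP := h x (mem_index_enum x); rewrite mulrC mul_conjC_eq0 => /(_ isT).
Qed.

(* Such an h is c times an orthogonal projector, whose complement c - h is
   positive as well. *)
Lemma inner_scaled_projector_le (X : finType) (h : hilb C X -> hilb C X)
    (c : C) phi :
  0 < c -> (forall a b, inner a (h b) = inner (h a) b) ->
  (forall a, h (h a) = c *: h a) -> inner phi (h phi) <= c * inner phi phi.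
Proof.
move=> c0 hsym hh.
have cc : c^* = c by apply/CrealP/gtr0_real.
have e1 : inner (h phi) (h phi) = c * inner phi (h phi).
  by rewrite -hsym hh innerZr.
have e2 : inner (h phi) phi = inner phi (h phi) by rewrite hsym.
(* The squared norm of (c - h) phi is c times the difference to be shown nonnegative. *)
have := inner_ge0 (c *: phi - h phi).
have -> : inner (c *: phi - h phi) (c *: phi - h phi) =
    c * c * inner phi phi - c * inner phi (h phi) - c * inner (h phi) phi
    + inner (h phi) (h phi).
  rewrite /inner !mulr_sumr -!sumrB -big_split; apply: eq_bigr => x _ /=.
  rewrite !ffunE /GRing.scale /= rmorphB rmorphM /= cc.
  by rewrite mulrBl !mulrBr; ring.
by rewrite e1 e2 subrK -mulrA -mulrBr pmulr_rge0 // subr_ge0.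
Qed.

End HilbertFacts.

(** * The operators [Ov] and the state [psi] on the vertex model *)

Section VertexModel.
Variables (R : realType) (d : nat) (L : colored_complex d).
Hypotheses (hd : (2 <= d)%N) (hL : lattice L R).
Variables (C : numClosedFieldType) (G : finGroupType).
Variable nu : {ffun 'I_d.+1 -> G} -> C.
Hypothesis hnu : cocycle nu.
Notation V := (vertex L).
Notation vconf := (vconf G L).
Notation H0 := (H0 C G L).
Notation upd x v g := ([ffun w => if w == v then g else x w] : vconf).

Lemma H0symP (phi : H0) :
  H0sym phi <-> forall g (x : vconf), phi [ffun v => (g * x v)%g] = phi x.
Proof.
have symE g (y : vconf) : sym_op g phi y = phi [ffun v => (g^-1 * y v)%g].
  rewrite /sym_op (@basis_mapE _ _ _ _
    (fun x : vconf => [ffun v => (g^-1 * x v)%g])) ?mul1r //.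
    by move=> x; apply/ffunP => v; rewrite !ffunE /Lplus mulKg.
  by move=> x; apply/ffunP => v; rewrite !ffunE /Lplus mulKVg.
split=> h g => [x|]; first by rewrite -[in RHS](h g^-1%g) symE invgK.
by apply/ffunP => x; rewrite symE h.
Qed.

(** As [g] runs over the group, so does [x v * g]: the right translations at [v] add up to a free
    sum over the value there, conjugated by [Unu]. *)
Lemma OvE v (phi : H0) x :
  Ov nu v phi x =
  spt_phase nu x * \sum_g (spt_phase nu (upd x v g))^* * phi (upd x v g).
Proof.
rewrite /Ov sum_ffunE mulr_sumr [RHS](reindex_inj (mulgI (x v))) /=.
apply: eq_bigr => g _.
pose f (y : vconf) : vconf :=
  [ffun w => if w == v then Lminus g^-1 (y w) else y w].
rewrite /Unu diagE /Lminus_at (@basis_mapE _ _ _ _ f) ?mul1r.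
- rewrite /Unu_dag diagE; congr (_ * ((spt_phase _ _)^* * phi _));
    apply/ffunP => w; rewrite !ffunE; case: eqP => // ->;
    by rewrite /Lminus invgK.
- move=> y; apply/ffunP => w; rewrite !ffunE.
  by case: eqP => // _; rewrite /Lminus invgK mulgKV.
- move=> y; apply/ffunP => w; rewrite !ffunE.
  by case: eqP => // _; rewrite /Lminus invgK mulgK.
Qed.

Lemma sum_upd_const v x (F : vconf -> C) (h : G) :
  \sum_g F (upd (upd x v h) v g) = \sum_g F (upd x v g).
Proof.
by apply: eq_bigr => g _; congr F; apply/ffunP => w; rewrite !ffunE; case: eqP.
Qed.

Lemma spt_conjK (x : vconf) (z : C) :
  (spt_phase nu x)^* * (spt_phase nu x * z) = z.
Proof. by rewrite mulrA [_^* * _]mulrC (spt_phase_norm hnu) mul1r. Qed.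

Lemma Ov_Ov v w (phi : H0) x : Ov nu v (Ov nu w phi) x = spt_phase nu x *
  \sum_g \sum_h
    (spt_phase nu (upd (upd x v g) w h))^* * phi (upd (upd x v g) w h).
Proof.
by rewrite OvE; congr (_ * _); apply: eq_bigr => g _; rewrite OvE spt_conjK.
Qed.

Lemma Ov_comm v w (phi : H0) : Ov nu v (Ov nu w phi) = Ov nu w (Ov nu v phi).
Proof.
have [->//|vw] := eqVneq v w.
apply/ffunP => x; rewrite !Ov_Ov exchange_big /=; congr (_ * _).
apply: eq_bigr => g _; apply: eq_bigr => h _.
have -> // : upd (upd x v h) w g = upd (upd x w g) v h.
apply/ffunP => u; rewrite !ffunE.
by case: (eqVneq u w) => // ->; rewrite eq_sym (negPf vw).
Qed.

(** The second update at [v] overwrites the first, so one of the two sums merely contributes the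
    factor [#|G|]. *)
Lemma Ov_idem v (phi : H0) :
  Ov nu v (Ov nu v phi) = (#|G|%:R : C) *: Ov nu v phi.
Proof.
apply/ffunP => x; rewrite Ov_Ov ffunE OvE /GRing.scale /= mulrCA; congr (_ * _).
rewrite mulr_natl -sumr_const; apply: eq_bigr => g _.
exact: (sum_upd_const v x (fun y => (spt_phase nu y)^* * phi y)).
Qed.

(** Exchanging the old and the new value at [v] is an involution on pairs (x, g) that swaps the
    roles of [a] and [b]. *)
Lemma Ov_selfadjoint v (a b : H0) : inner a (Ov nu v b) = inner (Ov nu v a) b.
Proof.
pose s := spt_phase (L := L) nu.
have -> : inner a (Ov nu v b) = \sum_(p : vconf * G)
    (a p.1)^* * (s p.1 * ((s (upd p.1 v p.2))^* * b (upd p.1 v p.2))).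
  rewrite -(pair_bigA _ (fun (x : vconf) g =>
    (a x)^* * (s x * ((s (upd x v g))^* * b (upd x v g))))) /=.
  by apply: eq_bigr => x _; rewrite OvE !mulr_sumr.
have -> : inner (Ov nu v a) b = \sum_(p : vconf * G)
    (s p.1 * ((s (upd p.1 v p.2))^* * a (upd p.1 v p.2)))^* * b p.1.
  rewrite -(pair_bigA _ (fun (x : vconf) g =>
    (s x * ((s (upd x v g))^* * a (upd x v g)))^* * b x)) /=.
  by apply: eq_bigr => x _; rewrite OvE mulr_sumr raddf_sum mulr_suml.
pose f (p : vconf * G) := (upd p.1 v p.2, p.1 v).
have fK : involutive f.
  move=> [x g]; congr (_, _); rewrite ?ffunE ?eqxx //.
  by apply/ffunP => w; rewrite !ffunE; case: eqP => // ->.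
rewrite (reindex_inj (inv_inj fK)); apply: eq_bigr => -[x g] _ /=.
have -> : upd (upd x v g) v (x v) = x.
  by apply/ffunP => w; rewrite !ffunE; case: eqP => // ->.
by rewrite !rmorphM /= conjCK; ring.
Qed.

Lemma Ov_sym v (phi : H0) : H0sym phi -> H0sym (Ov nu v phi).
Proof.
move=> /H0symP h; apply/H0symP => g x; rewrite !OvE (spt_phase_sym hd hL hnu).
congr (_ * _); rewrite (reindex_inj (mulgI g)); apply: eq_bigr => k _.
have -> : upd [ffun v => (g * x v)%g] v (g * k)%g =
    [ffun w => (g * upd x v k w)%g].
  by apply/ffunP => w; rewrite !ffunE; case: eqP.
by rewrite (spt_phase_sym hd hL hnu) h.
Qed.

(** All amplitudes of [plus] are equal, so [psi] is [Unu] applied to a uniform superposition over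
    all vertices, interior ones included. *)
Lemma psiE : exists2 c : C, c != 0 & forall x, psi L nu x = c * spt_phase nu x.
Proof.
pose k := (sqrtC (#|G|%:R : C))^-1.
have k0 : k != 0.
  rewrite invr_eq0 sqrtC_eq0 pnatr_eq0 -lt0n.
  by apply/card_gt0P; exists 1%g.
exists ((\prod_(v : V | v \notin bd_vertices L) k) *
        \prod_(v in bd_vertices L) k).
  by rewrite mulf_neq0 //; apply/prodf_neq0 => *.
by move=> x; rewrite ffunE /psi_trivial /psi_spt mulrAC -mulrA.
Qed.

Lemma psi_sym : H0sym (psi L nu).
Proof.
have [c _ e] := psiE; apply/H0symP => g x.
by rewrite !e (spt_phase_sym hd hL hnu).
Qed.

Lemma psi_neq0 : psi L nu != 0.
Proof.
have [c c0 e] := psiE; apply/eqP => /ffunP /(_ [ffun=> 1%g]).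
rewrite e ffunE => /eqP.
by rewrite mulf_eq0 (negPf c0) (negPf (spt_phase_neq0 hnu _)).
Qed.

Lemma Ov_psi v : Ov nu v (psi L nu) = (#|G|%:R : C) *: psi L nu.
Proof.
have [c _ e] := psiE; apply/ffunP => x; rewrite OvE ffunE e /GRing.scale /=.
rewrite (eq_bigr (fun=> c)) => [|g _]; last by rewrite e [c * _]mulrC spt_conjK.
by rewrite sumr_const -[c *+ _]mulr_natl mulrC -mulrA.
Qed.

End VertexModel.

(** * Flat edge configurations as gauge images *)

Section Flatness.
Variables (R : realType) (d : nat) (L : colored_complex d).
Hypothesis hL : lattice L R.
Variable G : finGroupType.
Notation V := (vertex L).
Notation vconf := (vconf G L).
Notation econf := (econf G L).

(** The version of [holonomy] for open paths, which is multiplicative under concatenation. *)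
Definition walk (e : econf) (u : V) (s : seq V) : G :=
  (\prod_(uw <- zip (u :: s) s) edge_step e uw.1 uw.2)%g.

Lemma walk_cons e u w s : walk e u (w :: s) = (edge_step e u w * walk e w s)%g.
Proof. by rewrite /walk /= big_cons. Qed.

Lemma walk_cat e u s t :
  walk e u (s ++ t) = (walk e u s * walk e (last u s) t)%g.
Proof.
elim: s u => [|w s IH] u /=; first by rewrite {2}/walk big_nil mul1g.
by rewrite !walk_cons IH mulgA.
Qed.

Lemma holonomy_walk e v p : holonomy (v :: p) e = walk e v (rcons p v).
Proof.
rewrite /holonomy /walk rot1_cons; congr bigop.body.
have sz : size (v :: p) = size (rcons p v) by rewrite size_rcons.
by have := zip_cat [:: v] [::] sz; rewrite cats1 !cats0 rcons_cons.
Qed.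

Lemma edge_step_gauge (x : vconf) u w : adj u w ->
  edge_step (gauge_conf x) u w = ((x u)^-1 * x w)%g.
Proof.
move=> uw; rewrite /edge_step; case: insubP => [k _ e|].
  by rewrite ffunE e.
rewrite /= uw /= -leqNgt => wu; case: insubP => [k _ e|].
  by rewrite ffunE e /= invMg invgK.
rewrite /= adj_sym uw /= -leqNgt => uw'.
have := color_proper hL uw; rewrite -val_eqE /= => /negP[].
by rewrite eqn_leq uw' wu.
Qed.

Lemma walk_gauge (x : vconf) u s : path (adj (L := L)) u s ->
  walk (gauge_conf x) u s = ((x u)^-1 * x (last u s))%g.
Proof.
elim: s u => [|w s IH] u /=; first by rewrite /walk big_nil mulVg.
by case/andP=> uw ws; rewrite walk_cons IH // edge_step_gauge // mulgA mulgK.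
Qed.

Lemma holonomy_gauge (x : vconf) c : path.cycle (adj (L := L)) c ->
  holonomy c (gauge_conf x) = 1%g.
Proof.
case: c => [|v p] /=; first by rewrite /holonomy big_nil.
by move=> vp; rewrite holonomy_walk walk_gauge // last_rcons mulVg.
Qed.

(** A discrete potential: the value at a vertex is the product along a chosen path from a base
    vertex. Trivial holonomy on all loops, contractible or not, makes it independent of the path. *)
Lemma gauge_conf_flat (e : econf) :
  (forall c, path.cycle (adj (L := L)) c -> holonomy c e = 1%g) ->
  exists x : vconf, e = gauge_conf x.
Proof.
move=> flat.
have closed u s : path (adj (L := L)) u s -> last u s = u -> walk e u s = 1%g.
  case/lastP: s => [|s w]; first by rewrite /walk big_nil.
  by move=> us; rewrite last_rcons => wu; subst w; rewrite -holonomy_walk flat.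
have /card_gt0P[v0 _] := lattice_neq0 hL.
have out v : exists s, path (adj (L := L)) v0 s && (last v0 s == v).
  have /connectP[s s1 s2] := lattice_connected hL v0 v.
  by exists s; rewrite s1 s2 eqxx.
exists [ffun v => walk e v0 (xchoose (out v))].
apply/ffunP => k; rewrite !ffunE.
have /andP[su /eqP eu] := xchooseP (out (val k).1).
have /andP[sw /eqP ew] := xchooseP (out (val k).2).
have /connectP[r r1 r2] := lattice_connected hL (val k).2 v0.
set s1 := xchoose _ in su eu *; set s2 := xchoose _ in sw ew *.
have /andP[ak ck] := valP k.
(* Both loops return to [v0] along the same path [r]; cancelling it compares the potential at the
   two ends of the edge [k]. *)
have c1 : walk e v0 (s1 ++ (val k).2 :: r) = 1%g.
  by apply: closed; rewrite ?cat_path ?last_cat ?su eu /= ?ak // -r2.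
have c2 : walk e v0 (s2 ++ r) = 1%g.
  by apply: closed; rewrite ?cat_path ?last_cat ?sw ew // -r2.
move: c1; rewrite -c2 !walk_cat eu ew walk_cons mulgA => /mulIg <-.
rewrite mulKg /edge_step; case: insubP => [k' _ e'|]; last by rewrite /= ak ck.
by congr (e _); apply: val_inj; rewrite e' -surjective_pairing.
Qed.

Lemma gauge_conf_fiber (x y : vconf) (v0 : V) : gauge_conf x = gauge_conf y ->
  forall v, x v = (x v0 * (y v0)^-1 * y v)%g.
Proof.
move=> exy v; have /connectP[s s1 ->] := lattice_connected hL v0 v.
have := walk_gauge x s1; rewrite exy walk_gauge // => e.
by rewrite -mulgA e mulKVg.
Qed.

End Flatness.

(** * Transfer of states and operators to the edges through [Gamma] *)

Section EdgeModel.
Variables (R : realType) (d : nat) (L : colored_complex d).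
Hypotheses (hd : (2 <= d)%N) (hL : lattice L R).
Variables (C : numClosedFieldType) (G : finGroupType).
Variable nu : {ffun 'I_d.+1 -> G} -> C.
Hypothesis hnu : cocycle nu.
Notation V := (vertex L).
Notation vconf := (vconf G L).
Notation econf := (econf G L).
Notation H0 := (H0 C G L).
Notation H1 := (H1 C G L).
Notation upd x v g := ([ffun w => if w == v then g else x w] : vconf).
Notation cardG := (#|G|%:R : C).

Lemma cardG_gt0 : 0 < cardG.
Proof. by rewrite ltr0n; apply/card_gt0P; exists 1%g. Qed.

Lemma sqrt_cardG_neq0 : sqrtC cardG != 0.
Proof. by rewrite sqrtC_eq0 gt_eqF // cardG_gt0. Qed.

(** The fiber over [gauge_conf x] is the orbit of [x] under left translations: [#|G|] configurations
    of equal amplitude, each weighted by |G|^(-1/2). *)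
Lemma Gamma_gauge (a : H0) (x : vconf) : H0sym a ->
  Gamma a (gauge_conf x) = sqrtC cardG * a x.
Proof.
move=> /H0symP ha; have /card_gt0P[v0 _] := lattice_neq0 hL.
rewrite ffunE (reindex_onto (fun g => [ffun v => (g * x v)%g] : vconf)
  (fun y : vconf => (y v0 * (x v0)^-1)%g)) /=; last first.
  move=> y /eqP eyx; apply/ffunP => v.
  by rewrite ffunE -(gauge_conf_fiber hL v0 eyx).
rewrite (eq_bigl xpredT) => [|g].
  rewrite (eq_bigr (fun=> (sqrtC cardG)^-1 * a x)) => [|g _];
    last by rewrite ha.
  rewrite sumr_const -[LHS]mulr_natl -{1}[_%:R]sqrtCK.
  by move: sqrt_cardG_neq0; move: (sqrtC _) => s s0; field.
rewrite ffunE mulgK eqxx andbT; apply/eqP/ffunP => k.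
by rewrite !ffunE invMg mulgA mulgKV.
Qed.

Lemma Gamma_notin (a : H0) e :
  (forall x : vconf, gauge_conf x != e) -> Gamma a e = 0.
Proof. by move=> h; rewrite ffunE big_pred0 // => x; exact: negPf (h x). Qed.

Lemma BloopE c (phi : H1) e : Bloop c phi e = (holonomy c e == 1%g)%:R * phi e.
Proof. exact: diagE. Qed.

Lemma gauge_confP (e : econf) :
  (exists x : vconf, e = gauge_conf x) \/ (forall x : vconf, gauge_conf x != e).
Proof.
have [/existsP[x /eqP <-]|/existsPn] :=
    boolP [exists x : vconf, gauge_conf x == e].
  by left; exists x.
by right.
Qed.

Lemma Gamma_sym (a : H0) : H1sym (Gamma a).
Proof.
move=> c cc; apply/ffunP => e; rewrite BloopE.
case: (gauge_confP e) => [[x ->]|ne]; last by rewrite Gamma_notin ?mulr0.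
by rewrite (holonomy_gauge hL) // eqxx mul1r.
Qed.

Lemma H1sym_Gamma (phi : H1) : H1sym phi ->
  exists2 a : H0, H0sym a & phi = Gamma a.
Proof.
move=> hphi; pose a : H0 := [ffun x => (sqrtC cardG)^-1 * phi (gauge_conf x)].
have ha : H0sym a.
  apply/H0symP => g x; rewrite !ffunE; congr (_ * phi _).
  by apply/ffunP => k; rewrite !ffunE invMg mulgA mulgKV.
exists a => //; apply/ffunP => e; case: (gauge_confP e) => [[x ->]|ne].
  by rewrite Gamma_gauge // ffunE mulVKf // sqrt_cardG_neq0.
rewrite Gamma_notin //; apply/eqP/contraT => pe.
(* A loop with nontrivial holonomy would make the amplitude at [e] vanish, so [e] is flat. *)
have [x ex] : exists x : vconf, e = gauge_conf x.
  apply: (gauge_conf_flat hL) => c cc.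
  have := congr1 (fun f : H1 => f e) (hphi c cc).
  rewrite BloopE; case: eqP => // _ /eqP.
  by rewrite mul0r eq_sym (negPf pe).
by have := ne x; rewrite ex eqxx.
Qed.

(** Only [Gamma b] is expanded over the fibers; its factor |G|^(-1/2) cancels the |G|^(1/2) from
    evaluating [Gamma a]. *)
Lemma inner_Gamma (a b : H0) : H0sym a -> H0sym b ->
  inner (Gamma a) (Gamma b) = inner a b.
Proof.
move=> ha hb; rewrite /inner
  [RHS](partition_big (@gauge_conf G d L) xpredT) //=.
apply: eq_bigr => e _; rewrite [Gamma b e]ffunE mulr_sumr.
apply: eq_bigr => x /eqP <-.
rewrite Gamma_gauge // rmorphM /= (CrealP _) ?sqrtC_real ?ltW ?cardG_gt0 //.
by rewrite mulrACA divff ?mul1r // sqrt_cardG_neq0.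
Qed.

(** The permutation of configurations underlying [Avg]; on gauge images it is induced by [Lminus g]
    at the single vertex [v]. *)
Definition gauge_shift (v : V) (g : G) (e : econf) : econf :=
  [ffun k : edge L =>
    if (val k).1 == v then Lplus g (e k)
    else if (val k).2 == v then Lminus g (e k)
    else e k].

Lemma gauge_shiftK v g : cancel (gauge_shift v g) (gauge_shift v g^-1).
Proof.
move=> e; apply/ffunP => k; rewrite !ffunE.
case: eqP => _; first by rewrite /Lplus mulKg.
by case: eqP => // _; rewrite /Lminus invgK mulgKV.
Qed.

Lemma gauge_shiftKV v g : cancel (gauge_shift v g^-1) (gauge_shift v g).
Proof. by move=> e; rewrite -{1}[g]invgK gauge_shiftK. Qed.

Lemma gauge_shift_conf v g (x : vconf) :
  gauge_shift v g (gauge_conf x) = gauge_conf (upd x v (x v * g^-1)%g).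
Proof.
apply/ffunP => k; have /andP[/andP[k12 _] _] := valP k.
rewrite !ffunE; case: (eqVneq (val k).1 v) => [e1|n1].
  rewrite -e1 eq_sym (negPf k12) /Lplus invMg invgK mulgA.
  by rewrite e1 -mulgA.
by case: eqP => // ->; rewrite /Lminus mulgA.
Qed.

Lemma AvgE v g (phi : H1) e : Avg v g phi e = phi (gauge_shift v g^-1 e).
Proof.
by rewrite /Avg
  (@basis_mapE _ _ _ (gauge_shift v g) (gauge_shift v g^-1) _ phi e
  (gauge_shiftK v g) (gauge_shiftKV v g)) mul1r.
Qed.

(** Shifts preserve the set of gauge images, so both sides vanish off it; on it [spt_phase_upd]
    matches the phases, for interior [v] as well. *)
Lemma Gamma_Ov v (a : H0) : H0sym a -> Gamma (Ov nu v a) = Ohat nu v (Gamma a).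
Proof.
move=> ha; have hOa := Ov_sym hd hL hnu v ha.
apply/ffunP => e; rewrite /Ohat sum_ffunE.
under eq_bigr => g _ do rewrite AvgE diagE.
case: (gauge_confP e) => [[x ->]|ne]; last first.
  rewrite Gamma_notin // big1 // => g _; rewrite Gamma_notin ?mulr0 // => x.
  apply: contra (ne (upd x v (x v * g^-1)%g)) => /eqP ex.
  by rewrite -gauge_shift_conf ex gauge_shiftKV.
rewrite Gamma_gauge // OvE mulrA mulr_sumr (reindex_inj (mulgI (x v))) /=.
apply: eq_bigr => g _; rewrite gauge_shift_conf invgK Gamma_gauge //.
set y := upd _ _ _.
(* [x] arises from [y] by a translation at [v], so the edge phase at [gauge_conf y] is the ratio of
   the phases of [x] and [y]. *)
have := spt_phase_upd hd hL hnu v g y.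
have -> : upd y v (y v * g^-1)%g = x.
  by apply/ffunP => w; rewrite !ffunE eqxx mulgK; case: eqP => // ->.
by move=> ->; rewrite -[RHS]mulr1 -(spt_phase_norm hnu y); ring.
Qed.

Lemma Av_Ohat v (phi : H1) : v \notin bd_vertices L ->
  Av v phi = cardG^-1 *: Ohat nu v phi.
Proof.
move=> vb; congr (_ *: _); apply: eq_bigr => g _; apply/ffunP => e.
rewrite !AvgE diagE /That_phase big_pred0 ?mul1r // => D.
apply/negP => /andP[DF vD].
by have := facet_bd_vertex hL DF vD; rewrite (negPf vb).
Qed.

(** The three vertices are pairwise adjacent, so their enumeration is one of the loops that define
    [H1sym]. *)
Lemma Bplaq_id (p : plaquette L) (phi : H1) :
  H1sym phi -> Bplaq (val p) phi = phi.
Proof.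
apply; have /andP[pK /eqP cp] := valP p.
have := enum_uniq (mem (val p)).
have : size (enum (val p)) = 3 by rewrite -cardE.
have memp w : w \in enum (val p) -> w \in val p by rewrite mem_enum.
case: (enum _) memp => [|u [|v [|w []]]] //= memp _.
rewrite !inE !negb_or !andbT => /andP[/andP[uv uw] vw].
have [up vp wp] : [/\ u \in val p, v \in val p & w \in val p].
  by split; apply: memp; rewrite !inE eqxx ?orbT.
by rewrite !(simplex_adj hL pK) // eq_sym.
Qed.

(** * The Hamiltonian terms pulled back to the vertex model *)

Definition vertex_weight (v : V) : C :=
  if v \in bd_vertices L then -1 else - cardG^-1.

(** What [Hterm] becomes on the vertex side: an interior [Av] is [Ohat] divided by [#|G|], whence
    the weight, and plaquette projectors fix flat states. *)
Definition lifted_term (t : V + plaquette L) (a : H0) : H0 :=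
  match t with
  | inl v => vertex_weight v *: Ov nu v a
  | inr _ => (-1 : C) *: a
  end.

Lemma GammaZ c (a : H0) : Gamma (c *: a) = c *: Gamma a.
Proof. exact: basis_mapZ. Qed.

Lemma Hterm_Gamma t (a : H0) : H0sym a ->
  Hterm nu t (Gamma a) = Gamma (lifted_term t a).
Proof.
move=> ha; case: t => [v|p] /=; rewrite GammaZ.
  rewrite Gamma_Ov // /vertex_weight; case: ifPn => vb.
    by rewrite scaleN1r.
  by rewrite Av_Ohat // scaleNr.
by rewrite Bplaq_id ?scaleN1r //; apply: Gamma_sym.
Qed.

Lemma H0symZ c (a : H0) : H0sym a -> H0sym (c *: a).
Proof. by move=> ha g; rewrite /sym_op basis_mapZ -/(sym_op g a) ha. Qed.

Lemma lifted_term_sym t (a : H0) : H0sym a -> H0sym (lifted_term t a).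
Proof.
by case: t => [v|p] ha; apply: H0symZ => //; apply: (Ov_sym hd hL hnu).
Qed.

Lemma OvZ v c (a : H0) : Ov nu v (c *: a) = c *: Ov nu v a.
Proof.
rewrite /Ov scaler_sumr; apply: eq_bigr => g _.
by rewrite /Unu /Unu_dag /diag /Lminus_at !basis_mapZ.
Qed.

Lemma lifted_term_comm t s (a : H0) :
  lifted_term t (lifted_term s a) = lifted_term s (lifted_term t a).
Proof.
by case: t s => [v|p] [w|q] //=; rewrite ?OvZ ?(Ov_comm hnu v w) // scalerA mulrC -scalerA.
Qed.

Lemma Hterm_commuting : commuting (@H1sym C G d L) (Hterm nu).
Proof.
split=> [t phi|t s phi] /H1sym_Gamma[a ha ->].
  by rewrite Hterm_Gamma //; apply: Gamma_sym.
have [hs ht] := (lifted_term_sym s ha, lifted_term_sym t ha).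
rewrite (Hterm_Gamma s ha) (Hterm_Gamma t hs)
  (Hterm_Gamma t ha) (Hterm_Gamma s ht).
by congr Gamma; apply: lifted_term_comm.
Qed.

Lemma energy_Hterm t (a : H0) : H0sym a ->
  energy (Hterm nu t) (Gamma a) = inner a (lifted_term t a) / inner a a.
Proof.
move=> ha; rewrite /energy Hterm_Gamma // !inner_Gamma //.
exact: lifted_term_sym.
Qed.

(** The witness is [Gamma psi]. The bound [#|G|] on [Ov] is attained at [psi] and the weights are
    negative, so its vertex energies are lowest; plaquette energies on [H1sym] are all -1. *)
Lemma Hterm_frustration_free : frustration_free (@H1sym C G d L) (Hterm nu).
Proof.
have hpsi := psi_sym hd hL hnu; have psi0 := psi_neq0 L hnu.
exists (Gamma (psi L nu)); split; first exact: Gamma_sym.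
  apply: contraNneq psi0 => /ffunP G0; apply/eqP/ffunP => x.
  have := G0 (gauge_conf x); rewrite Gamma_gauge // !ffunE => /eqP.
  by rewrite mulf_eq0 (negPf sqrt_cardG_neq0) => /eqP.
have Npsi : inner (psi L nu) (psi L nu) != 0 by rewrite gt_eqF // inner_gt0.
move=> t; rewrite /minimizes energy_Hterm //.
case: t => [v|p] /=.
  have w0 : vertex_weight v < 0.
    rewrite /vertex_weight; case: ifP => _;
      by rewrite oppr_lt0 ?ltr01 ?invr_gt0 ?cardG_gt0.
  rewrite Ov_psi // !innerZr mulrA mulfK //; split.
    by rewrite rpredM ?realn ?ltr0_real.
  move=> _ /H1sym_Gamma[a ha ->] G0; rewrite energy_Hterm // innerZr.
  have N0 : 0 < inner a a.
    apply: inner_gt0; apply: contraNneq G0 => ->; apply/eqP/ffunP => e.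
    by rewrite !ffunE big1 // => x _; rewrite ffunE mulr0.
  rewrite -mulrA ler_nM2l // ler_pdivrMr //.
  apply: inner_scaled_projector_le => //; first exact: cardG_gt0.
    exact: (Ov_selfadjoint nu v).
  exact: (Ov_idem hnu).
rewrite innerZr mulfK //; split; first by rewrite rpredN rpred1.
move=> _ /H1sym_Gamma[a ha ->] G0; rewrite energy_Hterm // innerZr.
have N0 : 0 < inner a a.
  apply: inner_gt0; apply: contraNneq G0 => ->; apply/eqP/ffunP => e.
  by rewrite !ffunE big1 // => x _; rewrite ffunE mulr0.
by rewrite mulfK // gt_eqF.
Qed.

Lemma Hhat_sum (phi : H1) : Hhat nu phi = \sum_t Hterm nu t phi.
Proof.
rewrite big_sumType /= sumrN /Hhat; congr (_ - _).
rewrite [RHS](bigID (mem (bd_vertices L))) /= addrC -!sumrN; congr (_ + _).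
  by apply: eq_bigr => v /negPf->.
by apply: eq_bigr => v ->.
Qed.

End EdgeModel.

Theorem mainTheorem2 (R : realType) (G : finGroupType) (d : nat)
    (L : colored_complex d) (nu : {ffun 'I_d.+1 -> G} -> R[i])
    (hd : (2 <= d)%N) (hL : lattice L R) (hnu : cocycle nu) :
  H0sym (psi L nu) /\
  (forall v : vertex L, v \in bd_vertices L ->
   forall phi : H0 R[i] G L, H0sym phi ->
     H0sym (Ov nu v phi) /\ Gamma (Ov nu v phi) = Ohat nu v (Gamma phi)) /\
  (forall phi : H1 R[i] G L, Hhat nu phi = \sum_t Hterm nu t phi) /\
  commuting (@H1sym R[i] G d L) (Hterm nu) /\
  frustration_free (@H1sym R[i] G d L) (Hterm nu).
Proof.
split; first exact: (psi_sym hd hL hnu).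
split.
  move=> v _ phi hphi; split; first exact: (Ov_sym hd hL hnu).
  exact: (Gamma_Ov hd hL hnu).
split; first exact: Hhat_sum.
split; first exact: (Hterm_commuting hd hL hnu).
exact: (Hterm_frustration_free hd hL hnu).
Qed.
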